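(* For every integer $n\ge 1$, $$I_n(q,t)=t\,I_{n-1}(q,t)+\sum_{k=0}^{n-2} q^{k+1}\, I_k(q,t)\, I_{n-k-1}(q,t).$$
   Context: For $n\ge 0$ let $\mathfrak S_n$ be the set of permutations of $[n]=\{1,\dots,n\}$, written in one-line notation $\sigma=b_1\ldots b_n$. A permutation $\sigma$ avoids $321$ if there are no indices $i<j<k$ with $b_i>b_j>b_k$; let $\mathrm{Av}_n(321)$ be the set of such $\sigma\in\mathfrak S_n$ (for $n=0$ it consists of the empty permutation). The inversion number is $\mathrm{inv}\,\sigma=\#\{(i,j): i<j,\ b_i>b_j\}$. An entry $b_i$ is a left-right maximum if $b_i=\max\{b_1,\dots,b_i\}$, and $\mathrm{lrm}\,\sigma$ denotes the number of left-right maxima of $\sigma$. Define $I_n(q,t)=\sum_{\sigma\in\mathrm{Av}_n(321)} q^{\mathrm{inv}\,\sigma}t^{\mathrm{lrm}\,\sigma}$, so $I_0(q,t)=1$. *)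

(* Defs.v *)
From mathcomp Require Import all_boot all_order all_fingroup all_algebra.
From mathcomp Require Import mpoly.

Set Implicit Arguments.
Unset Strict Implicit.
Unset Printing Implicit Defensive.

Import GRing.Theory.
Local Open Scope ring_scope.

(* A permutation b_1 ... b_n of [n] is encoded as s : 'S_n acting on          *)
(* {0, ..., n-1}, with b_i = s (i - 1) + 1; shifting positions and values by  *)
(* one changes none of the notions below.                                     *)

Definition avoids321 (n : nat) (s : 'S_n) : bool :=
  ~~ [exists i : 'I_n, exists j : 'I_n, exists k : 'I_n,
        [&& i < j, j < k, s j < s i & s k < s j]%N].

Definition invnum (n : nat) (s : 'S_n) : nat :=
  #|[set p : 'I_n * 'I_n | (p.1 < p.2)%N && (s p.2 < s p.1)%N]|.

Definition lrm (n : nat) (s : 'S_n) : nat :=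
  #|[set i : 'I_n | nat_of_ord (s i) == \max_(j < n | (j <= i)%N) s j]|.

(* The two indeterminates of Z[q, t] = {mpoly int[2]}. *)
Definition q : {mpoly int[2]} := 'X_(inord 0).
Definition t : {mpoly int[2]} := 'X_(inord 1).

Definition Inv_poly (n : nat) : {mpoly int[2]} :=
  \sum_(s : 'S_n | avoids321 s) q ^+ invnum s * t ^+ lrm s.

(* Main.v *)
(* Count positions and values from 0. Read a 321-avoiding permutation by taking its
   next position and its next value at each step, and delete every entry whose
   position and value have both been read. When n steps are left, what remains is
   a 321-avoiding permutation of size n + h whose first h entries are all at least
   h; let A(n, h) be the weighted sum over these. Testing entry h and then value h
   leads to
     A(n+1, h) = A(n, h+1) + (t + [h > 0]) q^h A(n, h)
                 + [h > 0] t q^(2h-1) A(n, h-1),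
   because 321-avoidance forces an entry h smaller than h to be 0, and then a value
   h among the first h + 1 entries to come first. Induction on n with this
   recurrence gives
     A(n, h+1) = sum_(k < n) q^(h+k+1) A(k, h) A(n-k, 0),
   and the theorem is A(n+1, 0) = A(n, 1) + t A(n, 0) at h = 0. *)

Require Import Defs.
From mathcomp Require Import all_boot all_order all_fingroup all_algebra.
From mathcomp Require Import mpoly ring zify.

Set Implicit Arguments.
Unset Strict Implicit.
Unset Printing Implicit Defensive.

Import GRing.Theory.
Local Open Scope ring_scope.

(** * Inserting and deleting one entry of a permutation *)

Lemma lift_ltn n (i : 'I_n.+1) (j k : 'I_n) : (lift i j < lift i k)%N = (j < k)%N.
Proof. by rewrite /= !ltnNge leq_bump2. Qed.

Lemma lift_ltn_pivot n (i : 'I_n.+1) (k : 'I_n) : (lift i k < i)%N = (k < i)%N.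
Proof. by rewrite /= /bump; case: leqP => /=; lia. Qed.

Lemma pivot_ltn_lift n (i : 'I_n.+1) (k : 'I_n) : (i < lift i k)%N = (i <= k)%N.
Proof. by rewrite /= /bump; case: leqP => /=; lia. Qed.

Lemma pivot_leq_lift n (i : 'I_n.+1) (k : 'I_n) : (i <= lift i k)%N = (i <= k)%N.
Proof. by rewrite /= /bump; case: leqP => /=; lia. Qed.

Lemma lift_perm_surj n (i j : 'I_n.+1) (s : 'S_n.+1) :
  s i = j -> exists s' : 'S_n, s = lift_perm i j s'.
Proof.
move=> sij.
have sl k : {k' | s (lift i k) = lift j k'}.
  have : j != s (lift i k) by rewrite -sij (inj_eq perm_inj) neq_lift.
  by move/unlift_some => [k' e _]; exists k'.
have inj_f : injective (fun k => sval (sl k)).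
  move=> k1 k2 /(congr1 (lift j)); rewrite -(svalP (sl k1)) -(svalP (sl k2)).
  by move=> /perm_inj/lift_inj.
exists (perm inj_f); apply/permP=> k; case: (unliftP i k) => [k'|] ->.
  by rewrite lift_perm_lift permE -(svalP (sl k')).
by rewrite lift_perm_id.
Qed.

Lemma lift_perm_inj n (i j : 'I_n.+1) : injective (@lift_perm n i j).
Proof.
move=> s1 s2 e; apply/permP=> k; apply: (@lift_inj _ j).
by rewrite -!(lift_perm_lift i) e.
Qed.

(** Inserting the entry [j] at position [i] is a bijection onto the permutations with that entry;
    both splittings below use it to delete an entry. *)
Lemma sum_lift_perm n (i j : 'I_n.+1) (V : nmodType) (P : pred 'S_n.+1)
    (F : 'S_n.+1 -> V) :
  \sum_(s | P s && (s i == j)) F s =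
  \sum_(s : 'S_n | P (lift_perm i j s)) F (lift_perm i j s).
Proof.
rewrite (reindex_omap (lift_perm i j) (fun s => [pick s' | s == lift_perm i j s'])).
  apply: eq_bigl => s'; rewrite lift_perm_id eqxx andbT.
  case: pickP => [s'' /eqP/lift_perm_inj<-|/(_ s')]; rewrite eqxx ?andbT //.
move=> s /andP[_ /eqP/lift_perm_surj[s' ->]]; case: pickP => [s'' /eqP->//|].
by move/(_ s'); rewrite eqxx.
Qed.

(** * Pointwise forms of avoidance and of the two statistics *)

Lemma avoids321P n (s : 'S_n) :
  reflect (forall i j k : 'I_n, (i < j)%N -> (j < k)%N ->
             (s j < s i)%N -> (s k < s j)%N -> False) (avoids321 s).
Proof.
apply: (iffP idP) => [/existsPn av i j k ij jk ji kj|av].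
  have /existsPn/(_ j)/existsPn/(_ k) := av i.
  by rewrite ij jk ji kj.
apply/existsPn=> i; apply/existsPn=> j; apply/existsPn=> k.
by apply/negP=> /and4P[]; apply: av.
Qed.

Lemma invnumE n (s : 'S_n) :
  invnum s = (\sum_(i < n) \sum_(j < n) ((i < j) && (s j < s i)))%N.
Proof.
rewrite /invnum -sum1_card pair_big big_mkcond /=.
by apply: eq_bigr => p _; rewrite inE; case: ifP.
Qed.

Lemma lrmE n (s : 'S_n) :
  lrm s = (\sum_(i < n) [forall j : 'I_n, (j < i) ==> (s j < s i)])%N.
Proof.
rewrite /lrm -sum1_card big_mkcond /=.
apply: eq_bigr => i _; rewrite inE.
suff -> : (nat_of_ord (s i) == \max_(j < n | (j <= i)%N) s j) =
          [forall j : 'I_n, (j < i)%N ==> (s j < s i)%N] by case: ifP.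
apply/eqP/forallP => [e j|lt_s].
  apply/implyP=> ji; rewrite ltn_neqAle; apply/andP; split.
    by apply: contraTN ji => /eqP/val_inj/perm_inj->; rewrite ltnn.
  by rewrite e (leq_bigmax_cond (F := fun j => nat_of_ord (s j))) // ltnW.
apply/eqP; rewrite eqn_leq (leq_bigmax_cond (F := fun j => nat_of_ord (s j))) //=.
apply/bigmax_leqP => j; rewrite leq_eqVlt => /orP[/eqP/val_inj-> //|ji].
by have /implyP/(_ ji)/ltnW := lt_s j.
Qed.

Definition prefix_geq (n a b : nat) (s : 'S_n) : bool :=
  [forall i : 'I_n, (i < a)%N ==> (b <= s i)%N].

(** Position and value are tested one after the other, so [a] exceeds [b] by one between the two
    tests. *)
Definition prefix_poly (n a b : nat) : {mpoly int[2]} :=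
  \sum_(s : 'S_n | avoids321 s && prefix_geq a b s) q ^+ invnum s * t ^+ lrm s.

Lemma prefix_geqP n a b (s : 'S_n) :
  reflect (forall i : 'I_n, (i < a)%N -> (b <= s i)%N) (prefix_geq a b s).
Proof. by apply: (iffP forallP) => H i; apply/implyP/H. Qed.

Lemma prefix_poly0 n a : prefix_poly n a 0 = Inv_poly n.
Proof.
apply: eq_bigl => s; have -> : prefix_geq a 0 s by apply/prefix_geqP.
by rewrite andbT.
Qed.

Lemma prefix_polynn n : prefix_poly n n n = (n == 0%N)%:R.
Proof.
case: n => [|n].
  rewrite /prefix_poly (big_pred1 1%g) => [|s].
    by rewrite invnumE lrmE !big_ord0 !expr0 mulr1.
  rewrite [RHS]/=; have -> : s == 1%g by apply/eqP/permP; case.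
  apply/andP; split; last by apply/prefix_geqP; case.
  by apply/avoids321P; case.
apply: big1 => s /andP[_ /prefix_geqP/(_ ord0 isT)].
by rewrite leqNgt ltn_ord.
Qed.

(** * Effect of one inserted entry *)

Lemma card_ord_ltn n m : (\sum_(i < n) (i < m : nat) = minn m n)%N.
Proof.
elim: n => [|n IH]; first by rewrite big_ord0 minn0.
by rewrite big_ord_recr IH /=; lia.
Qed.

Lemma sum_ord_lift n (i : 'I_n.+1) (F : 'I_n.+1 -> nat) :
  (\sum_(k < n.+1) F k = F i + \sum_(k < n) F (lift i k))%N.
Proof. exact: bigD1_ord. Qed.

(** The inserted entry is inverted with another one exactly when that one is earlier or smaller, but
    not both. *)
Lemma invnum_lift_perm n (i j : 'I_n.+1) (s : 'S_n) :
  invnum (lift_perm i j s) =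
  (invnum s + \sum_(k < n) ((k < i) (+) (s k < j)))%N.
Proof.
rewrite !invnumE (sum_ord_lift i) (sum_ord_lift i) !lift_perm_id.
rewrite !ltnn add0n [RHS]addnC.
have -> : (\sum_(k < n) \sum_(l < n.+1)
    ((lift i k < l) && (lift_perm i j s l < lift_perm i j s (lift i k))) =
  \sum_(k < n) ((k < i) && (j <= s k)) +
  \sum_(k < n) \sum_(l < n) ((k < l) && (s l < s k)))%N.
  rewrite -big_split; apply: eq_bigr => k _.
  rewrite (sum_ord_lift i) lift_perm_id lift_perm_lift lift_ltn_pivot pivot_ltn_lift.
  by congr addn; apply: eq_bigr => l _; rewrite lift_perm_lift !lift_ltn.
rewrite addnA; congr addn; rewrite -big_split; apply: eq_bigr => k _ /=.
rewrite lift_perm_lift lift_ltn_pivot pivot_ltn_lift.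
by rewrite leqNgt (leqNgt j); case: (k < i)%N; case: (s k < j)%N.
Qed.

Lemma forall_ord_lift n (i : 'I_n.+1) (P : pred 'I_n.+1) :
  [forall j, P j] = P i && [forall k : 'I_n, P (lift i k)].
Proof.
apply/forallP/andP => [P_all|[Pi /forallP P_lift] j].
  by split=> //; apply/forallP.
by case: (unliftP i j) => [k|] ->.
Qed.

(** The first term tests the inserted entry itself; an old left-right maximum survives unless it
    comes later and is smaller. *)
Lemma lrm_lift_perm n (i j : 'I_n.+1) (s : 'S_n) :
  lrm (lift_perm i j s) =
  ([forall k : 'I_n, (k < i)%N ==> (s k < j)%N] +
   \sum_(k < n) (((i <= k)%N ==> (j <= s k)%N) &&
                  [forall l : 'I_n, (l < k)%N ==> (s l < s k)%N]))%N.
Proof.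
rewrite lrmE (sum_ord_lift i) (forall_ord_lift i) ltnn implyFb lift_perm_id.
congr addn.
  congr (nat_of_bool _); apply: eq_forallb => k.
  by rewrite lift_perm_lift !lift_ltn_pivot.
apply: eq_bigr => k _; rewrite (forall_ord_lift i) lift_perm_id lift_perm_lift.
rewrite !pivot_ltn_lift; congr (nat_of_bool (_ && _)).
by apply: eq_forallb => l; rewrite lift_perm_lift !lift_ltn.
Qed.

Lemma avoids321_lift_perm n (i j : 'I_n.+1) (s : 'S_n) :
  avoids321 (lift_perm i j s) -> avoids321 s.
Proof.
move=> /avoids321P av; apply/avoids321P => a b c ab bc ba cb.
by apply: (av (lift i a) (lift i b) (lift i c)); rewrite ?lift_perm_lift lift_ltn.
Qed.

(* A descent among the first a entries would form a 321 with the value 0. *)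
Lemma increasing_prefix n a b (s : 'S_n) (i j : 'I_n) :
  (0 < b)%N -> avoids321 s -> prefix_geq a b s ->
  (i < j)%N -> (j < a)%N -> (s i < s j)%N.
Proof.
move=> b_gt0 /avoids321P av /prefix_geqP ge_b ij ja; rewrite ltnNge; apply/negP.
rewrite leq_eqVlt => /orP[/eqP/val_inj/perm_inj ji|sji]; first by rewrite ji ltnn in ij.
have n_gt0 : (0 < n)%N by apply: leq_ltn_trans (ltn_ord i).
pose p := (s^-1)%g (Ordinal n_gt0).
have sp : s p = 0%N :> nat by rewrite permKV.
have ap : (a <= p)%N.
  by rewrite leqNgt; apply/negP=> /ge_b; rewrite sp leqNgt b_gt0.
apply: (av i j p) => //; first exact: leq_trans ja ap.
by rewrite sp (leq_trans b_gt0) ?ge_b.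
Qed.

(* Splits on whether entry k+1 is 0, the only value below k+1 that it can take. *)
Lemma prefix_poly_row n k : (k < n)%N ->
  prefix_poly n.+1 k.+1 k.+1 =
  prefix_poly n.+1 k.+2 k.+1 + q ^+ k.+1 * prefix_poly n k.+1 k.
Proof.
move=> kn; have kn' : (k.+1 < n.+1)%N by [].
pose i0 := Ordinal kn'.
rewrite /prefix_poly (bigID (fun s : 'S_n.+1 => s i0 == ord0)) /= addrC.
congr (_ + _).
  apply: eq_bigl => s; rewrite -andbA; apply: andb_id2l => av.
  apply/andP/prefix_geqP => [[ge_k si0] i|ge_k].
    rewrite ltnS leq_eqVlt => /orP[/eqP ik|]; last exact/prefix_geqP.
    rewrite leqNgt; apply/negP=> sik.
    have {}ik : i = i0 by apply: val_inj.
    (* A nonzero value at most [k] here would be the middle of a 321: entry 0 exceeds it, and the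
       value 0, at [p], comes later. *)
    pose p := (s^-1)%g ord0; have sp : s p = ord0 by rewrite permKV.
    have kp : (k.+1 < p)%N.
      rewrite ltn_neqAle; apply/andP; split.
        by apply: contraNneq si0 => kp; apply/eqP; rewrite -sp; congr (s _); apply: val_inj.
      by rewrite leqNgt; apply/negP=> pk; have /prefix_geqP/(_ _ pk) := ge_k; rewrite sp.
    have/avoids321P/(_ ord0 i p) := av; apply; rewrite ?ik ?sp //.
      by rewrite -ik (leq_trans sik) //; have /prefix_geqP := ge_k; apply.
    by rewrite lt0n; apply: contraNneq si0 => e; apply/eqP/val_inj.
  split; first by apply/prefix_geqP => i ik; apply: ge_k; apply: ltnW.
  by apply: contraTneq (ge_k i0 (leqnn _)) => ->.
rewrite sum_lift_perm mulr_sumr; apply: eq_big => [s|s _]; last first.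
  (* A 0 that is not in first position is no left-right maximum and spoils no other. *)
  have -> : lrm (lift_perm i0 ord0 s) = lrm s.
    rewrite lrm_lift_perm lrmE [X in nat_of_bool X](_ : _ = false) ?add0n.
      by apply: eq_bigr => l _; rewrite implybT.
    by apply/negbTE/forallPn; exists (Ordinal (leq_ltn_trans (leq0n _) kn)).
  rewrite invnum_lift_perm addnC exprD -mulrA; congr (q ^+ _ * _).
  rewrite -[RHS](minn_idPl kn) -card_ord_ltn.
  by apply: eq_bigr => l _; rewrite addbF.
apply/andP/andP => -[av /prefix_geqP ge_k].
  split; first exact: avoids321_lift_perm av.
  apply/prefix_geqP=> l lk; have := ge_k (lift i0 l).
  by rewrite lift_ltn_pivot lift_perm_lift; apply.
split; last first.
  apply/prefix_geqP=> l; case: (unliftP i0 l) => [m|] ->; last by rewrite ltnn.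
  by rewrite lift_ltn_pivot lift_perm_lift => /ge_k.
apply/avoids321P=> a b c.
case: (unliftP i0 a) => [{}a|] ->; last by rewrite lift_perm_id.
case: (unliftP i0 b) => [{}b|] ->; last by rewrite lift_perm_id.
rewrite lift_ltn !lift_perm_lift lift_ltn => ab.
case: (unliftP i0 c) => [{}c|] ->.
  by rewrite lift_perm_lift !lift_ltn; have /avoids321P := av; apply.
(* A 321 ending in the inserted 0 needs a descent among the first [k.+1] entries. Two positions
   there force [k > 0], so these entries increase. *)
rewrite lift_ltn_pivot ltnS => bk; rewrite ltnNge => /negP ba _.
have k_gt0 : (0 < k)%N by apply: leq_trans bk; apply: leq_ltn_trans ab.
apply: ba; apply: ltnW; apply: (increasing_prefix (a := k.+1) k_gt0 av) => //.
exact/prefix_geqP.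
Qed.

(* Splits on whether entry 0 is h, the only one of the first h+1 that can be h. If
   so, deleting it creates no new left-right maximum: for h > 0 the next entry is
   at least h, so smaller values are still dominated. *)
Lemma prefix_poly_col n h : (h <= n)%N ->
  prefix_poly n.+1 h.+1 h =
  prefix_poly n.+1 h.+1 h.+1 + t * q ^+ h * prefix_poly n h h.
Proof.
move=> hn; have hn' : (h < n.+1)%N by [].
pose j0 := Ordinal hn'.
rewrite /prefix_poly (bigID (fun s : 'S_n.+1 => s ord0 == j0)) /= addrC.
congr (_ + _).
  apply: eq_bigl => s; rewrite -andbA; apply: andb_id2l => av.
  apply/andP/prefix_geqP => [[ge_h s0] i ih|ge_h].
    rewrite ltn_neqAle; have /prefix_geqP/(_ i ih) -> := ge_h; rewrite andbT.
    (* If the value [h] came at a later position of the prefix, monotonicity would put entry 0 below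
       [h]. *)
    apply/eqP=> si; have i_gt0 : (0 < i)%N.
      rewrite lt0n; apply: contraNneq s0 => i0; apply/eqP/val_inj.
      by rewrite /= si; congr (nat_of_ord (s _)); apply: val_inj.
    have h_gt0 : (0 < h)%N by apply: leq_trans i_gt0 ih.
    have := increasing_prefix h_gt0 av ge_h (i := ord0) i_gt0 ih.
    by rewrite -si ltnNge; have /prefix_geqP -> := ge_h.
  split; first by apply/prefix_geqP => i ih; apply/ltnW/ge_h.
  by apply: contraTneq (ge_h ord0 isT) => ->; rewrite ltnn.
rewrite sum_lift_perm mulr_sumr; apply: eq_big => [s|s /andP[av /prefix_geqP ge_h]].
  apply/andP/andP => -[av /prefix_geqP ge_h].
    split; first exact: avoids321_lift_perm av.
    apply/prefix_geqP=> l lh; have := ge_h (lift ord0 l) lh.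
    by rewrite lift_perm_lift -[h]/(nat_of_ord j0) pivot_leq_lift.
  split; last first.
    apply/prefix_geqP=> l; case: (unliftP ord0 l) => [m|] ->.
      by rewrite lift_perm_lift -[h]/(nat_of_ord j0) pivot_leq_lift; apply: ge_h.
    by rewrite lift_perm_id.
  apply/avoids321P=> a b c.
  case: (unliftP ord0 c) => [{}c|] -> //.
  case: (unliftP ord0 b) => [{}b|] -> //.
  rewrite !lift_perm_lift !lift_ltn.
  case: (unliftP ord0 a) => [{}a|] ->.
    by rewrite lift_perm_lift !lift_ltn; have /avoids321P := av; apply.
  (* In a 321 starting with the inserted [h], entry 0 of [s] can replace it: [b] has a value below
     [h], hence lies beyond the prefix. *)
  rewrite lift_perm_id lift_ltn_pivot => _ bc sb scb.
  have hb : (h <= b)%N by rewrite leqNgt; apply/negP=> /ge_h; rewrite leqNgt sb.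
  have h_gt0 : (0 < h)%N by apply: leq_ltn_trans sb.
  have n_gt0 : (0 < n)%N by apply: leq_ltn_trans (ltn_ord b).
  have /avoids321P/(_ (Ordinal n_gt0) b c) := av; apply=> //.
    exact: leq_trans hb.
  by apply: leq_trans sb _; apply: ge_h.
have -> : invnum (lift_perm ord0 j0 s) = (invnum s + h)%N.
  rewrite invnum_lift_perm -[in RHS](minn_idPl hn) -card_ord_ltn; congr addn.
  (* Reindexing by [s] counts the values below [h] instead of positions. *)
  by rewrite [RHS](reindex_inj (@perm_inj _ s)).
suff -> : lrm (lift_perm ord0 j0 s) = (lrm s).+1 by rewrite exprS exprD; ring.
rewrite lrm_lift_perm lrmE [X in nat_of_bool X](_ : _ = true); last by apply/forallP.
rewrite add1n; congr _.+1; apply: eq_bigr => l _ /=.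
case: forallP => [lmax|]; rewrite ?andbF // andbT.
case: (posnP h) => [->|h_gt0] //.
have n_gt0 : (0 < n)%N by apply: leq_trans hn.
have := ge_h (lift ord0 (Ordinal n_gt0)) h_gt0.
rewrite lift_perm_lift -[h in (h <= _)%N]/(nat_of_ord j0) pivot_leq_lift.
case: (posnP l) => [l0|l_gt0]; last first.
  by move=> /leq_trans-> //; rewrite ltnW //; have /implyP := lmax (Ordinal n_gt0); apply.
have -> : l = Ordinal n_gt0 by apply: val_inj.
by move=> ->.
Qed.

(* The polynomial A(n, h) of the header. *)
Definition open_poly n h := prefix_poly (n + h) h h.

Lemma open_poly0 n : open_poly n 0 = Inv_poly n.
Proof. by rewrite /open_poly addn0 prefix_poly0. Qed.

Lemma open_poly0n h : open_poly 0 h = (h == 0%N)%:R.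
Proof. exact: prefix_polynn. Qed.

Lemma open_polyS0 n : open_poly n.+1 0 = open_poly n 1 + t * open_poly n 0.
Proof.
rewrite /open_poly !addn0 addn1 (prefix_poly0 _ 0) -(prefix_poly0 _ 1).
by rewrite prefix_poly_col // expr0 mulr1.
Qed.

(** The row test gives two cases and the column test splits each; the two cases with exactly one
    deletion merge into the factor [t + 1]. *)
Lemma open_polySS n h : open_poly n.+1 h.+1 =
  open_poly n h.+2 + (t + 1) * q ^+ h.+1 * open_poly n h.+1 +
  t * q ^+ (h + h).+1 * open_poly n h.
Proof.
rewrite /open_poly addSn prefix_poly_row ?prefix_poly_col; try lia.
rewrite !addnS prefix_poly_col; last by lia.
by rewrite !exprS exprD; ring.
Qed.

Lemma open_poly_convolution n h :
  open_poly n h.+1 =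
  \sum_(k < n) q ^+ (h + k).+1 * open_poly k h * open_poly (n - k) 0.
Proof.
elim: n h => [|n IH] h; first by rewrite big_ord0 open_poly0n.
rewrite big_ord_recl subn0 addn0 open_poly0n.
case: h => [|h].
  (* By [open_polyS0], the 1 of [t + 1] and the last term of the recurrence form the summand k =
     0. *)
  transitivity (q * open_poly n.+1 0 + (open_poly n 2 + t * q * open_poly n 1)).
    by rewrite open_polySS open_polyS0 !expr1; ring.
  congr (_ + _); first by rewrite expr1 mulr1.
  rewrite !IH mulr_sumr -big_split.
  apply: eq_bigr => k _; rewrite lift0 subSS open_polyS0 !(addnS, addSn) !exprS.
  by rewrite add0n /=; ring.
(* The summand k = 0 vanishes; the others match termwise, by the recurrence for A(k+1, h+1). *)
rewrite mulr0 mul0r add0r open_polySS !IH !mulr_sumr -!big_split.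
apply: eq_bigr => k _; rewrite lift0 subSS open_polySS !(addnS, addSn) !exprS !exprD.
by rewrite /=; ring.
Qed.

Theorem theorem1p1 (n : nat) (hn : (1 <= n)%N) :
  Inv_poly n = t * Inv_poly (n - 1)%N
        + \sum_(0 <= k < n - 1) q ^+ (k + 1) * Inv_poly k * Inv_poly (n - k - 1)%N.
Proof.
case: n hn => // n _; rewrite subSS subn0 -!open_poly0 open_polyS0 addrC.
congr (_ + _); rewrite open_poly_convolution big_mkord.
apply: eq_bigr => k _; rewrite -!open_poly0 add0n addn1.
by congr (_ * open_poly _ _); lia.
Qed.
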